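(* Let $\mathcal{A}\in\mathbb{C}^{m\times n\times r}$, $\mathcal{B}\in\mathbb{C}^{h\times k\times r}$, $\mathcal{C}\in\mathbb{C}^{a\times b\times r}$, $\mathcal{D}\in\mathbb{C}^{l\times d\times r}$ be given tensors. If the system $\mathcal{A}\ltimes\mathcal{X}=\mathcal{B}$, $\mathcal{X}\ltimes\mathcal{C}=\mathcal{D}$ admits a solution $\mathcal{X}\in\mathbb{C}^{p\times q\times r}$, where $m\neq h$ and $l\neq p$, then $\mathcal{B}$ and $\mathcal{D}$ can be written in the block forms $$\mathcal{B}=\begin{bmatrix}\operatorname{Block}_{11}(\mathcal{B})&\cdots&\operatorname{Block}_{1q}(\mathcal{B})\\ \vdots&\ddots&\vdots\\ \operatorname{Block}_{m1}(\mathcal{B})&\cdots&\operatorname{Block}_{mq}(\mathcal{B})\end{bmatrix},\qquad \mathcal{D}=\begin{bmatrix}\operatorname{Block}_{11}(\mathcal{D})&\cdots&\operatorname{Block}_{1b}(\mathcal{D})\\ \vdots&\ddots&\vdots\\ \operatorname{Block}_{p1}(\mathcal{D})&\cdots&\operatorname{Block}_{pb}(\mathcal{D})\end{bmatrix},$$ where all blocks $\operatorname{Block}_{sj}(\mathcal{B})\in\mathbb{C}^{\frac{h}{m}\times\frac{k}{q}\times r}$ and $\operatorname{Block}_{gt}(\mathcal{D})\in\mathbb{C}^{\frac{l}{p}\times\frac{d}{b}\times r}$ are Toeplitz tensors, for $s=1,\dots,m$, $j=1,\dots,q$, $g=1,\dots,p$, $t=1,\dots,b$.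
   Context: Tensors are third-order arrays over $\mathbb{C}$, with all dimensions positive integers. An equality of tensors means that both the sizes and all entries agree. Block forms partition the first two indices into consecutive intervals of equal lengths, keeping the full third index. A third-order tensor is a Toeplitz tensor if every frontal slice (third index fixed) is a Toeplitz matrix, i.e. its entries $a_{i_1,i_2,i_3}$ depend only on $i_1-i_2$ and $i_3$. $[x,y]$ denotes the least common multiple. $I_{n\times n\times k}$ is the identity tensor: its first frontal slice is the $n\times n$ identity matrix and its other frontal slices are zero. The Kronecker product of $\mathcal{A}\in\mathbb{C}^{n_1\times n_2\times n_3}$ and $\mathcal{B}\in\mathbb{C}^{p_1\times p_2\times p_3}$ is the $n_1p_1\times n_2p_2\times n_3p_3$ tensor whose entry at position $((i_1-1)p_1+j_1,(i_2-1)p_2+j_2,(i_3-1)p_3+j_3)$ is $a_{i_1i_2i_3}b_{j_1j_2j_3}$. The t-product of $\mathcal{A}\in\mathbb{C}^{m\times n\times r}$ and $\mathcal{B}\in\mathbb{C}^{n\times s\times r}$ is $\mathcal{A}*\mathcal{B}\in\mathbb{C}^{m\times s\times r}$ whose $k$-th frontal slice is $\sum_{i+j\equiv k+1\ (\mathrm{mod}\ r)}\mathcal{A}_{(::i)}\mathcal{B}_{(::j)}$ (sum over $1\le i,j\le r$). The semi-tensor product of $\mathcal{A}\in\mathbb{C}^{m\times n\times r}$ and $\mathcal{B}\in\mathbb{C}^{p\times q\times s}$ is $\mathcal{A}\ltimes\mathcal{B}=(\mathcal{A}\otimes I_{\frac{t}{n}\times\frac{t}{n}\times\frac{e}{r}})*(\mathcal{B}\otimes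 I_{\frac{t}{p}\times\frac{t}{p}\times\frac{e}{s}})\in\mathbb{C}^{\frac{mt}{n}\times\frac{qt}{p}\times e}$, where $t=[n,p]$ and $e=[r,s]$. (Existence of a solution forces $\frac{h}{m},\frac{k}{q},\frac{l}{p},\frac{d}{b}$ to be positive integers.) *)

(* Defs.v *)
From mathcomp Require Import all_boot all_order all_algebra.
From mathcomp Require Import reals complex mxtens.

Set Implicit Arguments.
Unset Strict Implicit.
Unset Printing Implicit Defensive.

Import GRing.Theory.
Local Open Scope ring_scope.

(* A third-order tensor is stored as its family of frontal slices: the entry
   usually written a_{i1 i2 i3} is [A i3 i1 i2], with indices starting at 0. *)
Definition tensor (F : Type) (m n r : nat) := {ffun 'I_r -> 'M[F]_(m, n)}.

Section TensorDefs.

Variable F : pzRingType.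

(* The sizes may be equal without being convertible, so that Leibniz equality
   of tensors of the two sizes need not typecheck. *)
Definition tensor_eq m n r m' n' r'
    (A : tensor F m n r) (B : tensor F m' n' r') : Prop :=
  [/\ m = m', n = n', r = r' &
      forall (i : 'I_m) (j : 'I_n) (k : 'I_r)
             (i' : 'I_m') (j' : 'I_n') (k' : 'I_r'),
        i = i' :> nat -> j = j' :> nat -> k = k' :> nat ->
        A k i j = B k' i' j'].

Definition cast_tensor m n r m' n' r'
    (eq_m : m = m') (eq_n : n = n') (eq_r : r = r')
    (A : tensor F m n r) : tensor F m' n' r' :=
  [ffun k => castmx (eq_m, eq_n) (A (cast_ord (esym eq_r) k))].

Definition id_tensor n r : tensor F n n r :=
  [ffun k : 'I_r => if k == 0%N :> nat then 1%:M else 0].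

(* [mxtens_unindex k] is the pair (k %/ r2, k %% r2), also used by [*t]. *)
Definition kron_tensor m1 n1 r1 m2 n2 r2
    (A : tensor F m1 n1 r1) (B : tensor F m2 n2 r2) :
    tensor F (m1 * m2) (n1 * n2) (r1 * r2) :=
  [ffun k : 'I_(r1 * r2) =>
     A (mxtens_unindex k).1 *t B (mxtens_unindex k).2].

(* With indices starting at 0, i + j = k + 1 [mod r] becomes i + j = k. *)
Definition tprod m n s r (A : tensor F m n r) (B : tensor F n s r) :
    tensor F m s r :=
  [ffun k : 'I_r =>
     \sum_(i < r) \sum_(j < r | (i + j == k %[mod r])%N) A i *m B j].

Lemma lcmn_divKl n p : (n * (lcmn n p %/ n))%N = lcmn n p.
Proof. by rewrite mulnC divnK // dvdn_lcml. Qed.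

Lemma lcmn_divKr n p : (p * (lcmn n p %/ p))%N = lcmn n p.
Proof. by rewrite mulnC divnK // dvdn_lcmr. Qed.

Definition stprod m n r p q s (A : tensor F m n r) (B : tensor F p q s) :
    tensor F (m * (lcmn n p %/ n)) (q * (lcmn n p %/ p)) (lcmn r s) :=
  tprod
    (cast_tensor (erefl _) (lcmn_divKl n p) (lcmn_divKl r s)
       (kron_tensor A (id_tensor (lcmn n p %/ n) (lcmn r s %/ r))))
    (cast_tensor (lcmn_divKr n p) (erefl _) (lcmn_divKr r s)
       (kron_tensor B (id_tensor (lcmn n p %/ p) (lcmn r s %/ s)))).

Definition toeplitz_mx m n (M : 'M[F]_(m, n)) : Prop :=
  forall (i i' : 'I_m) (j j' : 'I_n),
    i%:Z - j%:Z = i'%:Z - j'%:Z -> M i j = M i' j'.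

Definition toeplitz_tensor m n r (A : tensor F m n r) : Prop :=
  forall k : 'I_r, toeplitz_mx (A k).

Definition block_tensor m q u v r (Blk : 'I_m -> 'I_q -> tensor F u v r) :
    tensor F (\sum_(s < m) u) (\sum_(j < q) v) r :=
  [ffun k : 'I_r => \mxblock_(s < m, j < q) Blk s j k].

(* [u %/ m] and [v %/ q] are truncated quotients, but the equality of sizes
   in [tensor_eq] forces m to divide u and q to divide v. *)
Definition toeplitz_blocks m q u v r (B : tensor F u v r) : Prop :=
  exists Blk : 'I_m -> 'I_q -> tensor F (u %/ m) (v %/ q) r,
    tensor_eq B (block_tensor Blk) /\
    (forall (s : 'I_m) (j : 'I_q), toeplitz_tensor (Blk s j)).

End TensorDefs.

Arguments toeplitz_blocks {F} m q {u v r} B.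

(* Main.v *)
(** Write [u = t/n] and [v = t/p] with [t = lcm(n, p)].  Entries of a frontal
    slice of [A (x) I_u] vanish unless the row and column indices agree
    modulo [u], and are unchanged when both indices are incremented inside a
    block of length [u]; likewise for [X (x) I_v].  Reindexing the sum
    [\sum_c S x c * T c y] by [c |-> c + 1 mod t] then shows that every slice
    of a semi-tensor product is unchanged when both indices are incremented
    inside a [u]-by-[v] block, i.e., that these blocks are Toeplitz. *)
Require Import Defs.
From mathcomp Require Import all_boot all_order all_algebra.
From mathcomp Require Import reals complex.
From mathcomp Require Import mxtens zify.

Section SemiTensorToeplitz.

Set Implicit Arguments.
Unset Strict Implicit.

Import GRing.Theory.
Local Open Scope ring_scope.

Variable F : pzRingType.

(** The aligned [u]-by-[u] blocks are scalar matrices. Stating this through index values, with no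
    factorization of [m] or [n], lets it survive casts of the sizes. *)
Definition block_scalar u m n (M : 'M[F]_(m, n)) : Prop :=
  (forall (x : 'I_m) (c : 'I_n), x <> c %[mod u] -> M x c = 0) /\
  (forall (x x' : 'I_m) (c c' : 'I_n),
     x' = x.+1 :> nat -> c' = c.+1 :> nat ->
     ~~ (u %| x')%N -> ~~ (u %| c')%N -> M x' c' = M x c).

Definition block_toeplitz u v m n (M : 'M[F]_(m, n)) : Prop :=
  forall (x x' : 'I_m) (y y' : 'I_n),
    x' = x.+1 :> nat -> y' = y.+1 :> nat ->
    ~~ (u %| x')%N -> ~~ (v %| y')%N -> M x' y' = M x y.

Lemma block_scalar_cast u m n m' n' (e : (m = m') * (n = n'))
  (M : 'M[F]_(m, n)) : block_scalar u M -> block_scalar u (castmx e M).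
Proof. by case: e => em en; case: m' / em; case: n' / en. Qed.

Lemma divn_succ_ndvd u x : (0 < u)%N -> ~~ (u %| x.+1)%N ->
  (x.+1 %/ u = x %/ u)%N.
Proof. by move=> u_gt0 /negbTE ndvd; rewrite divnS // ndvd. Qed.

Lemma block_scalar_tens u m n (M : 'M[F]_(m, n)) (a : F) :
  block_scalar u (M *t (a%:M : 'M_u)).
Proof.
split=> [x c neq_xc | x x' c c' ex ec ndx ndc].
  rewrite !mxE -val_eqE /=.
  by have /eqP/negbTE-> := neq_xc; rewrite mulr0n mulr0.
(* For [u = 0] the index type of [x] would be empty. *)
have u_gt0 : (0 < u)%N by case: u x {x' ex ndx} c {c' ec ndc} => // -[? /[!muln0]].
rewrite !mxE -!val_eqE /=.
congr (M _ _ * _).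
- by apply: val_inj; rewrite /= ex divn_succ_ndvd // -ex.
- by apply: val_inj; rewrite /= ec divn_succ_ndvd // -ec.
by rewrite ex ec !modnS -ex -ec (negbTE ndx) (negbTE ndc) eqSS.
Qed.

Lemma block_scalar_kron_id u m n r e (A : tensor F m n r) k :
  block_scalar u (kron_tensor A (id_tensor F u e) k).
Proof.
rewrite !ffunE; case: ifP => _; first exact: block_scalar_tens.
(* A zero slice is the scalar matrix of [0], so the same lemma covers it. *)
rewrite -[X in _ *t X](raddf0 (@scalar_mx F u)); exact: block_scalar_tens.
Qed.

Lemma block_scalar_mul u v m t n (S : 'M[F]_(m, t)) (T : 'M[F]_(t, n)) :
    (u %| t)%N -> (v %| t)%N -> block_scalar u S -> block_scalar v T ->
  block_toeplitz u v (S *m T).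
Proof.
move=> dvd_ut dvd_vt [S0 Ssh] [T0 Tsh] x x' y y' ex ey ndx ndy.
rewrite !mxE (reindex_inj (@ordS_inj t)); apply: eq_bigr => c _ /=.
(* Wrapping around at [t] preserves residues modulo any divisor [w] of [t]. *)
have agree w z : (w %| t)%N ->
    (z.+1 == ordS c %[mod w])%N = (z == c %[mod w])%N.
  by move=> wt; rewrite /= modn_dvdm // -addn1 -[c.+1]addn1 eqn_modDr.
(* If [c] is congruent to [z], then [c + 1] is not a multiple of [w], hence differs from [t]: no
   wrap-around occurs. *)
have succ_c w z : (w %| t)%N -> ~~ (w %| z.+1)%N -> (z == c %[mod w])%N ->
    ordS c = c.+1 :> nat /\ ~~ (w %| ordS c)%N.
  move=> wt ndz; rewrite -agree // => /eqP zc.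
  have ndo : ~~ (w %| ordS c)%N by rewrite /dvdn -zc.
  split=> //=; rewrite modn_small // ltn_neqAle ltn_ord andbT.
  by apply: contraNneq ndo => /= ct; rewrite ct modnn dvdn0.
(* Off the congruence classes, the old and the new factor both vanish, so the only terms left to
   compare are those where the shift is a true successor. *)
have [xc|nxc] := boolP (x == c %[mod u])%N; last first.
  rewrite (S0 x c); last by apply/eqP.
  by rewrite S0 ?mul0r //; apply/eqP; rewrite ex agree.
have [yc|nyc] := boolP (y == c %[mod v])%N; last first.
  rewrite (T0 c y); last by apply/eqP; rewrite eq_sym.
  by rewrite T0 ?mulr0 //; apply/eqP; rewrite eq_sym ey agree.
rewrite ex in ndx; rewrite ey in ndy.
have [eS ndS] := succ_c _ _ dvd_ut ndx xc.
have [_ ndT] := succ_c _ _ dvd_vt ndy yc.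
by congr (_ * _); [apply: Ssh => //; rewrite ex | apply: Tsh => //; rewrite ey].
Qed.

Lemma block_toeplitz_stprod m n r p q s (A : tensor F m n r)
    (X : tensor F p q s) k :
  block_toeplitz (lcmn n p %/ n) (lcmn n p %/ p) (stprod A X k).
Proof.
move=> x x' y y' ex ey ndx ndy.
(* A slice of the t-product is a sum of matrix products, and shift invariance can be checked term by
   term. *)
rewrite !ffunE !summxE; apply: eq_bigr => i _.
rewrite !summxE; apply: eq_bigr => j _.
apply: block_scalar_mul ex ey ndx ndy.
- by apply/dvdnP; exists n; rewrite lcmn_divKl.
- by apply/dvdnP; exists p; rewrite lcmn_divKr.
- by rewrite ffunE; apply/block_scalar_cast/block_scalar_kron_id.
- by rewrite ffunE; apply/block_scalar_cast/block_scalar_kron_id.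
Qed.

Lemma toeplitz_mx_shift m n (M : 'M[F]_(m, n)) :
    (forall (i i' : 'I_m) (j j' : 'I_n),
       i' = i.+1 :> nat -> j' = j.+1 :> nat -> M i' j' = M i j) ->
  toeplitz_mx M.
Proof.
move=> shift.
have up d : forall (i i' : 'I_m) (j j' : 'I_n),
    i' = (i + d)%N :> nat -> j' = (j + d)%N :> nat -> M i' j' = M i j.
  elim: d => [|d IHd] i i' j j' ei ej.
    by congr (M _ _); apply: val_inj; rewrite /= ?ei ?ej addn0.
  have lti : (i + d < m)%N by have := ltn_ord i'; lia.
  have ltj : (j + d < n)%N by have := ltn_ord j'; lia.
  rewrite (shift (Ordinal lti) i' (Ordinal ltj) j') /=; [|lia|lia].
  exact: IHd.
move=> i i' j j' e.
(* Equal differences make one index pair a diagonal translate of the other; the order of the rows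
   tells which one to move up. *)
have [le_ii'|lt_i'i] := leqP i i'.
  by rewrite (up (i' - i)%N i i' j j') //; lia.
by rewrite (up (i - i')%N i' i j' j) //; lia.
Qed.

Lemma toeplitz_blocksP m q h k r (B : tensor F h k r) :
    (m %| h)%N -> (q %| k)%N ->
    (forall t, block_toeplitz (h %/ m) (k %/ q) (B t)) ->
  toeplitz_blocks m q B.
Proof.
move=> dvd_mh dvd_qk shift.
have eh : (m * (h %/ m))%N = h by rewrite mulnC divnK.
have ek : (q * (k %/ q))%N = k by rewrite mulnC divnK.
exists (fun s j => [ffun t => \matrix_(i, i')
  B t (cast_ord eh (mxtens_index (s, i))) (cast_ord ek (mxtens_index (j, i')))]).
(* With equal widths, the total width of the blocks before [x] collapses to a product, matching the
   index given by [mxtens_index]. *)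
have rankE w z (x : 'I_(\sum_(s < w) z)) :
    x = (tagnat.sig1 x * z + tagnat.sig2 x)%N :> nat.
  apply: etrans (tagnat.rect x) _; congr (_ + _)%N.
  set i := tagnat.sig1 x.
  rewrite -(big_ord_widen w (fun=> z) (ltnW (ltn_ord i))).
  by rewrite sum_nat_const card_ord.
split; last first.
  move=> s j t; apply: toeplitz_mx_shift => i i' y y' ei ey.
  rewrite !ffunE !mxE.
  (* A successor inside a block has offset strictly between [0] and [z], so it never starts a new
     block. *)
  have ndvd w z (a : 'I_z) : a = w.+1 :> nat -> forall e, ~~ (z %| e * z + a)%N.
    move=> ea e; rewrite dvdn_addr ?dvdn_mull // gtnNdvd ?ea //.
    by rewrite -ea ltn_ord.
  by apply: shift; rewrite /= ?(ndvd _ _ _ ei) ?(ndvd _ _ _ ey) // ?ei ?ey addnS.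
split; rewrite ?sum_nat_const ?card_ord ?eh ?ek //.
move=> x y t x' y' t' ex ey et; rewrite !ffunE !mxE ffunE !mxE.
have -> : t' = t by exact: val_inj.
by congr (B t _ _); apply: val_inj; rewrite /= -rankE.
Qed.

Lemma toeplitz_blocks_stprod m n r p q s h k e (A : tensor F m n r)
    (X : tensor F p q s) (B : tensor F h k e) :
    (0 < m)%N -> (0 < q)%N ->
  tensor_eq (stprod A X) B -> toeplitz_blocks m q B.
Proof.
move=> m_gt0 q_gt0 [eh ek ee eAB]; move: B eAB.
case: h / eh; case: k / ek; case: e / ee => B eAB.
apply: toeplitz_blocksP; rewrite ?dvdn_mulr // => t.
(* Positivity of [m] and [q] identifies the block sizes with [lcmn n p %/ n] and [lcmn n p %/ p]. *)
rewrite !mulKn // => x x' y y' ex ey ndx ndy.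
rewrite -(eAB x' y' t) // -(eAB x y t) //.
exact: block_toeplitz_stprod ex ey ndx ndy.
Qed.

End SemiTensorToeplitz.

Theorem theorem5p5 (R : realType) (m n h k a b l d p q r : nat)
    (m_gt0 : 0 < m) (n_gt0 : 0 < n) (h_gt0 : 0 < h) (k_gt0 : 0 < k)
    (a_gt0 : 0 < a) (b_gt0 : 0 < b) (l_gt0 : 0 < l) (d_gt0 : 0 < d)
    (p_gt0 : 0 < p) (q_gt0 : 0 < q) (r_gt0 : 0 < r)
    (A : tensor R[i] m n r) (B : tensor R[i] h k r)
    (C : tensor R[i] a b r) (D : tensor R[i] l d r)
    (neq_mh : m <> h) (neq_lp : l <> p)
    (solvable : exists X : tensor R[i] p q r,
       tensor_eq (stprod A X) B /\ tensor_eq (stprod X C) D) :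
  toeplitz_blocks m q B /\ toeplitz_blocks p b D.
Proof.
have [X [AXB XCD]] := solvable.
by split; [apply: toeplitz_blocks_stprod AXB | apply: toeplitz_blocks_stprod XCD].
Qed.
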